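(* Let $D\subset\mathbb{C}^n$ be a bounded B-regular domain. Then Edwards' duality theorem does not hold in $D$: there exist a convex cone $F\subset C(D)$ containing the constants and a bounded lower semicontinuous function $g:D\to\mathbb{R}$ such that $Sg(z)\neq Ig(z)$ for some $z\in D$.
   Context: A bounded domain $D\subset\mathbb{C}^n$ is B-regular if every real-valued continuous function on $\partial D$ extends to a function that is continuous on $\overline D$ and plurisubharmonic on $D$. Let $F\subset C(D)$ be a convex cone of real-valued continuous functions on $D$ containing the constants. For $z\in D$ let $J^F_z(D)$ be the set of Borel probability measures $\mu$ with compact support contained in $D$ such that $u(z)\le\int_{D}u\,d\mu$ for all $u\in F$. For $g:D\to\mathbb{R}$ and $z\in D$ define $$Sg(z)=\sup\{u(z): u\in F,\ u\le g \text{ on } D\},\qquad Ig(z)=\inf\Big\{\int_{D}g\,d\mu : \mu\in J^F_z(D)\Big\}.$$ Edwards' duality theorem is the assertion that $Sg=Ig$ for bounded lower semicontinuous $g$ (valid when the underlying set is compact). *)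

(* Defs.v *)
From HB Require Import structures.
From mathcomp Require Import all_boot all_order all_algebra.
From mathcomp Require Import all_classical all_reals all_analysis.
From mathcomp Require Import complex.
Set Implicit Arguments.
Unset Strict Implicit.
Unset Printing Implicit Defensive.
Import Order.TTheory GRing.Theory Num.Theory.
Import numFieldNormedType.Exports.
Local Open Scope classical_set_scope.
Local Open Scope ring_scope.
Local Open Scope complex_scope.

(* The space C^n is 'rV[R[i]^o]_n with R : realType: the alias R[i]^o is what  *)
(* carries the topology of the complex field R[i].                            *)
(* A function on a subset D of a space T is represented by a total function   *)
(* on T; every definition below only looks at its values on D. Semicontinuity *)
(* and continuity on D refer to the subspace topology of D.                   *)

Section semicontinuity.
Context {T : topologicalType} {R : realType}.
Implicit Types (A : set T) (f : T -> \bar R).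

Definition boundary A : set T := closure A `\` interior A.

Definition lsc_on A f := lower_semicontinuous (f : subspace A -> \bar R).

Definition usc_on A f :=
  lower_semicontinuous ((fun x => - f x)%E : subspace A -> \bar R).

End semicontinuity.

Section plurisubharmonic.
Context {R : realType}.

Definition circle_mean (u : R[i]^o -> \bar R) (w : R[i]^o) (r : R) : \bar R :=
  (((2 * pi)^-1)%:E *
   \int[lebesgue_measure]_(t in `[0%R, (2 * pi)%R])
     u (w + r%:C * (cos t +i* sin t))%R)%E.

(* The values are in [-oo, +oo[; the function -oo is allowed. *)
Definition subharmonic (W : set R[i]^o) (u : R[i]^o -> \bar R) :=
  [/\ usc_on W u,
      forall w, W w -> (u w < +oo)%E &
      forall w (r : R), 0 < r -> [set l | `|l - w| <= r%:C] `<=` W ->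
        (u w <= circle_mean u w r)%E].

Definition plurisubharmonic n (D : set 'rV[R[i]^o]_n)
    (u : 'rV[R[i]^o]_n -> \bar R) :=
  [/\ usc_on D u,
      forall z, D z -> (u z < +oo)%E &
      forall a b : 'rV[R[i]^o]_n,
        subharmonic [set l | D (a + l *: b)] (fun l => u (a + l *: b))].

Definition bounded_domain n (D : set 'rV[R[i]^o]_n) :=
  [/\ open D, connected D, D !=set0 & bounded_set D].

Definition B_regular n (D : set 'rV[R[i]^o]_n) :=
  forall f : 'rV[R[i]^o]_n -> R, {within boundary D, continuous f} ->
  exists u : 'rV[R[i]^o]_n -> R,
    [/\ {within closure D, continuous u},
        plurisubharmonic D (EFin \o u) &
        forall z, boundary D z -> u z = f z].

End plurisubharmonic.

Definition convex_cone (R : realType) (E : lmodType R) (F : set E) :=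
  forall s t : R, 0 <= s -> 0 <= t ->
  forall u v, F u -> F v -> F (s *: u + t *: v).

Section edwards.
Context {R : realType} {n : nat}.
Local Notation V := 'rV[R[i]^o]_n.
Local Notation borel := (g_sigma_algebraType (@open V)).
Implicit Types (D : set V) (F : set (V -> R)) (g : V -> R) (z : V).

Definition measure_support (mu : probability borel R) : set V :=
  [set z | forall U : set V, open U -> U z -> (0 < mu U)%E].

(* Borel probability measures on D are seen as Borel measures on C^n. *)
Definition jensen_measures D F z : set (probability borel R) :=
  [set mu | [/\ compact (measure_support mu), measure_support mu `<=` D &
     forall u, F u -> ((u z)%:E <= \int[mu]_(w in D) (u w)%:E)%E]].

Definition edwards_sup D F g z : \bar R :=
  ereal_sup [set (u z)%:E | u in
    [set u : V -> R | F u /\ forall w, D w -> u w <= g w]].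

Definition edwards_inf D F g z : \bar R :=
  ereal_inf [set (\int[mu]_(w in D) (g w)%:E)%E | mu in jensen_measures D F z].

End edwards.

(* Main.v *)
Require Import Defs.
From HB Require Import structures.
From mathcomp Require Import all_boot all_order all_algebra.
From mathcomp Require Import all_classical all_reals all_analysis.
From mathcomp Require Import measurable_realfun complex ring lra.
Set Implicit Arguments.
Unset Strict Implicit.
Unset Printing Implicit Defensive.
Import Order.TTheory GRing.Theory Num.Theory.
Import numFieldNormedType.Exports.
Local Open Scope classical_set_scope.
Local Open Scope ring_scope.
Local Open Scope complex_scope.

(* Fix z0 in D and a point p of the closure of D outside D, and put           *)
(* k z = |z - z0| |z - p|, g z = - |z - z0| and F = {a - t k | t >= 0}.       *)
(* In D the function k >= 0 vanishes only at z0, so the inequality for - k    *)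
(* forces every Jensen measure at z0 to give no mass to D minus z0, whence    *)
(* Ig(z0) >= 0. But k also vanishes at the missing point p, and a - t k <= g  *)
(* on D yields a <= g p by passing to the limit, so Sg(z0) <= g p < 0.        *)

(** Edwards' theorem fails because [D] is not compact. Competitors in the supremum extend
    continuously to the missing point [p] and are constrained there by [g], whereas Jensen measures
    live inside [D] and never charge [p]. Such a [p] exists because a nonempty bounded open set of
    positive dimension is not closed ([bounded_clopen_eq0]). Continuity of the real-valued norm
    [renorm] gives continuity of [k] and [g], and [continuous_measurable_borel] turns it into
    measurability for the integrals. *)

Section real_norm.
Context {R : realType} {V : normedModType R[i]}.
Implicit Types (x y : V).

(* Norms over R[i] take their values in R[i]. *)
Definition renorm x : R := complex.Re `|x|.

Lemma renormE x : (renorm x)%:C = `|x|.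
Proof. by apply: RRe_real; exact: normr_real. Qed.

Lemma renorm_ge0 x : 0 <= renorm x.
Proof. by rewrite -lecR renormE normr_ge0. Qed.

Lemma renorm0_eq0 x : renorm x = 0 -> x = 0.
Proof. by move=> x0; apply/eqP; rewrite -normr_eq0 -renormE x0. Qed.

Lemma renorm0 : renorm 0 = 0.
Proof. by rewrite /renorm normr0. Qed.

Lemma renormD x y : renorm (x + y) <= renorm x + renorm y.
Proof. by rewrite -lecR rmorphD /= !renormE ler_normD. Qed.

Lemma renormN x : renorm (- x) = renorm x.
Proof. by rewrite /renorm normrN. Qed.

Lemma normc_real (s : R) : `|s%:C| = `|s|%:C :> R[i].
Proof. by rewrite normc_def /= expr0n addr0 sqrtr_sqr. Qed.

Lemma renormZ (s : R) x : renorm (s%:C *: x) = `|s| * renorm x.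
Proof.
by apply: complexI; rewrite rmorphM/= !renormE normrZ normc_real.
Qed.

Lemma dist_renorm x y : `|renorm x - renorm y| <= renorm (x - y).
Proof.
have xy := renormD (x - y) y; have yx := renormD (y - x) x.
rewrite -(renormN (y - x)) opprB !subrK in xy yx.
by rewrite ler_norml; lra.
Qed.

Lemma renorm_continuous : continuous renorm.
Proof.
move=> x; apply/cvgrPdist_lt => e e0.
have e0' : 0 < e%:C :> R[i] by rewrite ltcR.
near=> y; apply: le_lt_trans (dist_renorm _ _) _.
rewrite -ltcR renormE; near: y.
by have /cvgrPdist_lt/(_ _ e0') := @cvg_id _ (nbhs x).
Unshelve. all: by end_near. Qed.

Lemma renorm_subr_continuous y : continuous (fun x => renorm (x - y)).
Proof.
move=> x; apply: (@continuous_comp _ _ _ (fun x => x - y) renorm).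
  by apply: cvgB; [exact: cvg_id|exact: cvg_cst].
exact: renorm_continuous.
Qed.

Lemma bounded_set_renorm (A : set V) : bounded_set A ->
  exists M, forall x, A x -> renorm x <= M.
Proof.
(* [bounded_set] only provides bounds strictly above [M], hence the [+ 1]. *)
move=> [M [Mr AM]]; exists (complex.Re M + 1) => x Ax.
rewrite -lecR renormE; apply: AM => //.
by rewrite rmorphD/= RRe_real// ltrDl.
Qed.

End real_norm.

Lemma line_continuous (R : realType) (V : normedModType R[i]) (z v : V) :
  continuous (fun s : R => z + s%:C *: v).
Proof.
move=> s; apply/cvgrPdist_lt => e e0; have ee : e = (complex.Re e)%:C.
  by rewrite RRe_real// gtr0_real.
move: e0; rewrite ee ltcR => e0.
near=> t.
rewrite opprD addrACA subrr add0r -scalerBl -rmorphB/= -renormE ltcR renormZ.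
(* The [+ 1] keeps the divisor positive even when [v] is zero. *)
apply: le_lt_trans (_ : `|s - t| * (renorm v + 1) < _).
  by rewrite ler_wpM2l// lerDl.
rewrite -ltr_pdivlMr ?ltr_wpDl ?renorm_ge0//; near: t.
have /cvgrPdist_lt := @cvg_id _ (nbhs s); apply.
by rewrite divr_gt0// ltr_wpDl ?renorm_ge0.
Unshelve. all: by end_near. Qed.

(** A real line in direction [v] through a point of [A] meets [A] in a nonempty clopen set of
    parameters. As the real line is connected, [A] contains the whole line, which is unbounded. *)
Lemma bounded_clopen_eq0 (R : realType) (V : normedModType R[i]) (v : V)
    (A : set V) :
  v != 0 -> open A -> closed A -> bounded_set A -> A = set0.
Proof.
move=> v0 oA cA /bounded_set_renorm[M AM]; apply/eqP.
apply: contrapT => /negP/set0P[z Az].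
have /connected_intervalP cR : is_interval [set: R] by [].
pose f (s : R) := z + s%:C *: v.
have fA : f @^-1` A = setT.
  apply: cR.
  - by exists 0; rewrite /f /preimage/= scale0r addr0.
  - exists (f @^-1` A); rewrite ?setTI//.
    by move/continuousP: (@line_continuous _ _ z v); exact.
  - exists (f @^-1` A); rewrite ?setTI//.
    by move/continuous_closedP: (@line_continuous _ _ z v); exact.
have v_gt0 : 0 < renorm v.
  rewrite lt_neqAle renorm_ge0 andbT eq_sym.
  by apply: contra_neq v0 => /renorm0_eq0.
(* At this parameter the displacement has norm [M + renorm z + 1], too long to join two points of
   norm at most [M] and [renorm z]. *)
have : [set: R] ((M + renorm z + 1) / renorm v) by [].
rewrite -fA /f => /AM.
have := AM _ Az.
set s := _ / _ => zM.
have s0 : 0 <= s.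
  apply: divr_ge0; last exact: ltW.
  by have := renorm_ge0 z; lra.
have := renormD (z + s%:C *: v) (- z).
rewrite addrAC subrr add0r renormN renormZ (ger0_norm s0) /s divfK ?gt_eqF//.
lra.
Qed.

Lemma continuous_measurable_borel (R : realType) (T : ptopologicalType)
    (f : T -> R) : continuous f ->
  measurable_fun setT (f : g_sigma_algebraType (@open T) -> R).
Proof.
move=> /continuousP cf; apply: (measurability _ (RGenOpens.measurableE R)).
move=> _ [_ [a [b ->] <-]]; rewrite setTI; apply: sub_sigma_algebra.
by apply: cf; exact: interval_open.
Qed.

Theorem mainTheorem4 (R : realType) (n : nat) (D : set 'rV[R[i]^o]_n)
    (n_gt0 : (0 < n)%N) (domD : bounded_domain D) (regD : B_regular D) :
  exists (F : set ('rV[R[i]^o]_n -> R)) (g : 'rV[R[i]^o]_n -> R),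
    [/\ forall u, F u -> {within D, continuous u},
        convex_cone F,
        forall c : R, F (cst c),
        [bounded g x | x in D] /\ lsc_on D (EFin \o g) &
        exists z, D z /\ edwards_sup D F g z <> edwards_inf D F g z].
Proof.
move: domD => [oD _ [z0 Dz0] bD].
(* Otherwise [D] would be clopen and bounded, hence empty, although it contains [z0]. *)
have [p clDp Dp] : exists2 p, closure D p & ~ D p.
  apply: contrapT => noP.
  have v0 : const_mx 1 != 0 :> 'rV[R[i]^o]_n.
    apply/eqP => /rowP/(_ (Ordinal n_gt0)); rewrite !mxE => /eqP.
    by rewrite oner_eq0.
  have cD : closed D.
    by move=> p clDp; apply: contrapT => Dp; apply: noP; exists p.
  by have := bounded_clopen_eq0 v0 oD cD bD; move: Dz0 => /[swap] ->.
pose d (q z : 'rV[R[i]^o]_n) : R := renorm (z - q).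
have cd q : continuous (d q) by exact: renorm_subr_continuous.
pose k z := d z0 z * d p z.
have ck : continuous k by move=> z; apply: continuousM; exact: cd.
pose g z := - d z0 z.
have cg : continuous g by move=> z; apply: continuousN; exact: cd.
have k_ge0 z : 0 <= k z by rewrite mulr_ge0// renorm_ge0.
pose F : set ('rV[R[i]^o]_n -> R) :=
  [set u | exists a t : R, 0 <= t /\ u = (fun z => a - t * k z)].
have cF u : F u -> continuous u.
  move=> [a [t [_ ->]]] z.
  apply: (@continuousB _ _ _ (cst a) (cst t \* k)); first exact: cst_continuous.
  by apply: continuousM; [exact: cst_continuous|exact: ck].
exists F, g; split.
- by move=> u /cF cu; exact: continuous_subspaceT.
- move=> s t s0 t0 _ _ [a [x [x0 ->]]] [b [y [y0 ->]]].
  exists (s * a + t * b), (s * x + t * y); split.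
    by rewrite addr_ge0// mulr_ge0.
  by apply/funext => z; rewrite !fctE /GRing.scale/=; ring.
- by move=> c; exists c, 0; split => //; apply/funext => z; rewrite mul0r subr0.
- split.
    have [M DM] := bounded_set_renorm bD.
    exists (M + renorm z0); split; first exact: num_real.
    move=> y /ltW My z Dz /=; apply: le_trans My.
    rewrite /g normrN ger0_norm ?renorm_ge0//.
    apply: le_trans (renormD _ _) _.
    by rewrite renormN lerD2r DM.
  apply/lower_semicontinuousP => a.
  have /continuousP := @continuous_subspaceT _ _ D _ cg.
  by move=> /(_ _ (@open_gt R a)).
exists z0; split => //.
suff : (edwards_sup D F g z0 < edwards_inf D F g z0)%E.
  by move=> /[swap] ->; rewrite ltxx.
apply: (@le_lt_trans _ _ (g p)%:E).
  apply: ge_ereal_sup => _ [u [Fu ug] <-]; rewrite lee_fin.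
  (* The set where [u - g] is at most 0 is closed and contains [D], so it contains [p]. *)
  have ugp : u p - g p <= 0.
    have cug : continuous (u \- g).
      by move=> z; apply: continuousB; [exact: cF|exact: cg].
    have /continuous_closedP/(_ _ (@closed_le R 0))/closure_id cle := cug.
    have Dle : D `<=` (u \- g) @^-1` [set x | x <= 0].
      by move=> z Dz; rewrite /preimage/= subr_le0 ug.
    by have := closureS Dle clDp; rewrite -cle.
  move: Fu ugp => [a [t [_ ->]]]; rewrite subr_le0 /k /d !subrr renorm0.
  by rewrite mul0r !mulr0.
apply: (@lt_le_trans _ _ 0%E).
  (* Strictness holds because [p] differs from [z0], which lies in [D]. *)
  rewrite lte_fin oppr_lt0 lt_neqAle renorm_ge0 andbT eq_sym.
  apply/eqP => /renorm0_eq0/eqP; rewrite subr_eq0 => /eqP pz0.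
  by apply: Dp; rewrite pz0.
apply: le_ereal_inf_tmp => _ [mu [_ _ Jmu] <-].
have mD : measurable (D : set (g_sigma_algebraType (@open 'rV[R[i]^o]_n))).
  exact: sub_sigma_algebra.
have mE (f : 'rV[R[i]^o]_n -> R) : continuous f ->
    measurable_fun (D : set (g_sigma_algebraType (@open 'rV[R[i]^o]_n)))
      (fun z => (f z)%:E).
  move=> cf; apply/measurable_EFinP; apply: measurable_funTS.
  exact: continuous_measurable_borel.
(* The Jensen inequality for [- k], which vanishes at [z0], bounds the integral of [k] above by
   0. *)
have k0 : (\int[mu]_(z in D) `|(k z)%:E| = 0)%E.
  apply/eqP; rewrite eq_le integral_ge0 ?andbT//.
  have : F (fun z => 0 - 1 * k z) by exists 0, 1.
  move=> /Jmu; rewrite {1}/k /d subrr renorm0 mul0r mulr0 subrr.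
  under eq_integral do rewrite sub0r mul1r EFinN.
  rewrite integral_ge0N => [|z _]; last by rewrite lee_fin.
  rewrite leeNr oppe0; under [X in (_ -> X <= _)%E]eq_integral do
    rewrite gee0_abs ?lee_fin//.
  by [].
have := (ae_eq_integral_abs mu mD (mE _ ck)).1 k0 => aek.
rewrite (@ae_eq_integral _ _ _ mu D (cst 0%E) (fun z => (g z)%:E)) //.
- by rewrite integral0.
- exact: mE.
(* On [D] a zero of [k] can only be [z0], since [p] is outside [D]; hence [g] is 0 almost everywhere
   for [mu]. *)
apply: filterS aek => z kz Dz; move: (kz Dz) => /= [] /eqP.
rewrite mulf_eq0 => /orP[/eqP z0z|/eqP/renorm0_eq0/eqP].
  by rewrite /g z0z oppr0.
by rewrite subr_eq0 => /eqP zp; move: Dz; rewrite zp.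
Qed.
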